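(* Let $\mathcal R=\langle\mathbb R,<,+,\dots\rangle$ be an o-minimal expansion of $\langle\mathbb R,<,+\rangle$. Then the theory of the structure $\mathcal M=\langle\mathbb R,<,+,\{B: B\subseteq\mathbb R^n\text{ bounded and }\mathcal R\text{-definable}, n\ge1\},\mathbb Z,(x\mapsto ax)_{a\in\mathbb Q},\lambda\rangle$ eliminates quantifiers, where $\lambda(x)=\max(\mathbb Z\cap(-\infty,x])$.
   Context: $\mathcal R$-definable means definable in $\mathcal R$ with parameters. The language of $\mathcal M$ has $<$, $+$, a relation symbol for each bounded $\mathcal R$-definable set, a unary predicate for $\mathbb Z$, a unary function symbol for each scalar multiplication $x\mapsto ax$ with $a\in\mathbb Q$, and a unary function symbol for $\lambda$ (the floor function). *)

(* Defs.v *)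
From HB Require Import structures.
From mathcomp Require Import all_boot all_order all_algebra.
From mathcomp Require Import boolp classical_sets reals constructive_ereal.

Set Implicit Arguments.
Unset Strict Implicit.
Unset Printing Implicit Defensive.

Import Order.TTheory GRing.Theory Num.Theory.

Local Open Scope classical_set_scope.
Local Open Scope ring_scope.

(** * First-order logic with equality *)

Record language : Type := Language {
  fsym : Type;
  farity : fsym -> nat;
  rsym : Type;
  rarity : rsym -> nat }.

Record structure (L : language) (T : Type) : Type := Structure {
  finterp : forall f : fsym L, ('I_(farity f) -> T) -> T;
  rinterp : forall r : rsym L, ('I_(rarity r) -> T) -> Prop }.

(* [term L n] and [formula L n]: at most the variables 0, ..., n-1 are free. *)
Inductive term (L : language) (n : nat) : Type :=
| Var of 'I_n
| App (f : fsym L) of ('I_(farity f) -> term L n).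

(* The other connectives and the existential quantifier are the usual classical
   abbreviations. The variable bound by [FAll] has index 0 in the body. *)
Inductive formula (L : language) : nat -> Type :=
| FBot (n : nat) : formula L n
| FEq (n : nat) : term L n -> term L n -> formula L n
| FRel (n : nat) (r : rsym L) : ('I_(rarity r) -> term L n) -> formula L n
| FImp (n : nat) : formula L n -> formula L n -> formula L n
| FAll (n : nat) : formula L n.+1 -> formula L n.

Definition sentence (L : language) : Type := formula L 0.

Fixpoint quantifier_free (L : language) (n : nat) (phi : formula L n) : bool :=
  match phi with
  | FBot _ | FEq _ _ _ | FRel _ _ _ => true
  | FImp _ phi1 phi2 => quantifier_free phi1 && quantifier_free phi2
  | FAll _ _ => false
  end.

Fixpoint eval (L : language) (T : Type) (S : structure L T) (n : nat)
    (e : 'I_n -> T) (t : term L n) : T :=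
  match t with
  | Var i => e i
  | App f ts => finterp S (fun i => eval S e (ts i))
  end.

Definition env_cons (T : Type) (n : nat) (a : T) (e : 'I_n -> T)
    (i : 'I_n.+1) : T :=
  if unlift ord0 i is Some j then e j else a.

Definition env_cat (T : Type) (n m : nat) (x : 'I_n -> T) (b : 'I_m -> T)
    (i : 'I_(n + m)) : T :=
  match split i with inl j => x j | inr j => b j end.

Fixpoint sat (L : language) (T : Type) (S : structure L T) (n : nat)
    (phi : formula L n) : ('I_n -> T) -> Prop :=
  match phi in formula _ n0 return ('I_n0 -> T) -> Prop with
  | FBot _ => fun _ => False
  | FEq _ t u => fun e => eval S e t = eval S e u
  | FRel _ _ ts => fun e => rinterp S (fun i => eval S e (ts i))
  | FImp _ phi1 phi2 => fun e => sat S phi1 e -> sat S phi2 e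
  | FAll _ phi1 => fun e => forall a : T, sat S phi1 (env_cons a e)
  end.

Definition sentence_true (L : language) (T : Type) (S : structure L T)
    (phi : sentence L) : Prop :=
  forall e : 'I_0 -> T, sat S phi e.

Definition theory_of (L : language) (T : Type) (S : structure L T) :
    set (sentence L) :=
  [set phi | sentence_true S phi].

Definition model (L : language) (Th : set (sentence L)) (T : Type)
    (S : structure L T) : Prop :=
  forall phi : sentence L, Th phi -> sentence_true S phi.

Definition equiv_modulo (L : language) (Th : set (sentence L)) (n : nat)
    (phi psi : formula L n) : Prop :=
  forall (T : Type) (S : structure L T), inhabited T -> model Th S ->
  forall e : 'I_n -> T, sat S phi e <-> sat S psi e.

Definition eliminates_quantifiers (L : language) (Th : set (sentence L)) :
    Prop :=
  forall (n : nat) (phi : formula L n),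
  exists psi : formula L n, quantifier_free psi /\ equiv_modulo Th phi psi.

(* Definability with parameters [b]. *)
Definition definable (L : language) (T : Type) (S : structure L T) (n : nat)
    (A : set ('I_n -> T)) : Prop :=
  exists (m : nat) (phi : formula L (n + m)) (b : 'I_m -> T),
    A = [set x | sat S phi (env_cat x b)].

Definition language_sum (L1 L2 : language) : language :=
  {| fsym := fsym L1 + fsym L2;
     farity := fun f => match f with inl g => farity g | inr g => farity g end;
     rsym := rsym L1 + rsym L2;
     rarity := fun r => match r with inl q => rarity q | inr q => rarity q end
  |}.

Definition structure_sum (L1 L2 : language) (T : Type)
    (S1 : structure L1 T) (S2 : structure L2 T) :
    structure (language_sum L1 L2) T :=
  {| finterp := fun f : fsym (language_sum L1 L2) =>
       match f return ('I_(@farity (language_sum L1 L2) f) -> T) -> T with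
       | inl g => finterp S1 (f := g)
       | inr g => finterp S2 (f := g)
       end;
     rinterp := fun r : rsym (language_sum L1 L2) =>
       match r return ('I_(@rarity (language_sum L1 L2) r) -> T) -> Prop with
       | inl q => rinterp S1 (r := q)
       | inr q => rinterp S2 (r := q)
       end |}.

(** * Expansions of the ordered additive group of the reals *)

Variant og_fsym : Type := og_add.
Variant og_rsym : Type := og_lt.

Definition og_language : language :=
  {| fsym := og_fsym; farity := fun=> 2%N;
     rsym := og_rsym; rarity := fun=> 2%N |}.

Definition og_structure (R : realType) : structure og_language R :=
  {| finterp := fun (f : fsym og_language) (x : 'I_2 -> R) =>
       x ord0 + x ord_max;
     rinterp := fun (r : rsym og_language) (x : 'I_2 -> R) =>
       (x ord0 < x ord_max : Prop) |}.

(* [I] interprets the symbols other than < and +. *)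
Definition og_expansion (R : realType) (L : language) (I : structure L R) :
    structure (language_sum og_language L) R :=
  structure_sum (og_structure R) I.

(* A finite union of points and open intervals with endpoints in \bar R. *)
Definition finite_union_points_intervals (R : realType) (A : set R) : Prop :=
  exists (ps : seq R) (js : seq (\bar R * \bar R)),
  forall x : R, A x <->
    (x \in ps \/ exists2 j, j \in js & (j.1 < x%:E)%E /\ (x%:E < j.2)%E).

Definition o_minimal (R : realType) (L : language) (S : structure L R) :
    Prop :=
  forall A : set R, definable S [set x : 'I_1 -> R | A (x ord0)] ->
  finite_union_points_intervals A.

Definition bounded_subset (R : realType) (n : nat) (B : set ('I_n -> R)) :
    Prop :=
  exists M : R, forall x, B x -> forall i, `|x i| <= M.

Record bounded_definable (R : realType) (L : language) (S : structure L R) :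
    Type := BoundedDefinable {
  bd_dim : nat;
  bd_set : set ('I_bd_dim -> R);
  bd_dim_gt0 : (0 < bd_dim)%N;
  bd_bounded : bounded_subset bd_set;
  bd_definable : definable S bd_set }.

Variant M_fsym : Type :=
| M_add
| M_scale of rat
| M_floor.

Variant M_rsym (R : realType) (L : language) (S : structure L R) : Type :=
| M_lt
| M_bounded of bounded_definable S
| M_int.

Definition M_language (R : realType) (L : language) (S : structure L R) :
    language :=
  {| fsym := M_fsym;
     farity := fun f =>
       match f with M_add => 2 | M_scale _ => 1 | M_floor => 1 end%N;
     rsym := M_rsym S;
     rarity := fun r =>
       match r with M_lt => 2 | M_bounded B => bd_dim B | M_int => 1 end%N |}.

Definition M_structure (R : realType) (L : language) (S : structure L R) :
    structure (M_language S) R :=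
  {| finterp := fun f : fsym (M_language S) =>
       match f return ('I_(@farity (M_language S) f) -> R) -> R with
       | M_add => fun x : 'I_2 -> R => x ord0 + x ord_max
       | M_scale a => fun x : 'I_1 -> R => ratr a * x ord0
       | M_floor => fun x : 'I_1 -> R => (Num.floor (x ord0))%:~R
       end;
     rinterp := fun r : rsym (M_language S) =>
       match r return ('I_(@rarity (M_language S) r) -> R) -> Prop with
       | M_lt => fun x : 'I_2 -> R => (x ord0 < x ord_max : Prop)
       | M_bounded B => bd_set (b := B)
       | M_int => fun x : 'I_1 -> R => (x ord0 \is a Num.int : Prop)
       end |}.

(* Main.v *)
(* Via x = floor x + frac x, the structure M is the Presburger integers glued to [0, 1[ with its
   R-definable sets: addition, rational scalings, < and bounded definable sets only involve carries
   and shifts from a finite set, so their graphs are finite unions of products P * D, with P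
   Presburger and D R-definable. An existential quantifier over such a union splits into a
   quantifier over the integers, eliminated by Cooper's argument, and one over [0, 1[, under which
   definable sets are closed. Finally P (floor x) and D (frac x) are quantifier-free in M. As the
   theory is complete, equivalence in M itself is enough. *)
Require Import Defs.
From mathcomp Require Import all_boot all_order all_algebra.
From mathcomp Require Import boolp classical_sets reals.
From mathcomp Require Import zify ring lra.

Set Implicit Arguments.
Unset Strict Implicit.
Unset Printing Implicit Defensive.

Import Order.TTheory GRing.Theory Num.Theory.

Local Open Scope classical_set_scope.
Local Open Scope ring_scope.

(** * Boolean classes of sets *)

(** Falsity and implication are the propositional primitives of [formula]; the other connectives
    follow classically. The record is instantiated for definable, Presburger, split and
    quantifier-free definable sets. *)
Record boolean_class (X : Type) (C : set (set X)) : Prop := BooleanClass {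
  class_bot : C [set _ | False];
  class_imp : forall A B, C A -> C B -> C [set x | A x -> B x] }.

Lemma class_ext (X : Type) (C : set (set X)) (A B : set X) :
  (forall x, A x <-> B x) -> C A -> C B.
Proof. by move=> AB; rewrite (_ : A = B) //; apply/seteqP; split=> x /AB. Qed.

Section BooleanClassTheory.
Context (X : Type) (C : set (set X)) (hC : boolean_class C).

Lemma class_not (A : set X) : C A -> C [set x | ~ A x].
Proof. by move=> CA; exact: (class_imp hC CA (class_bot hC)). Qed.

Lemma class_top : C [set _ | True].
Proof. by apply: class_ext (class_not (class_bot hC)) => x /=; split=> // _ []. Qed.

Lemma class_or (A B : set X) : C A -> C B -> C [set x | A x \/ B x].
Proof.
move=> CA CB; apply: class_ext (class_imp hC (class_not CA) CB) => x /=.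
by split=> [AB|[//|//]]; have [/AB|/contrapT] := pselect (~ A x); [right|left].
Qed.

Lemma class_and (A B : set X) : C A -> C B -> C [set x | A x /\ B x].
Proof.
move=> CA CB; apply: class_ext (class_not (class_imp hC CA (class_not CB))) => x /=.
by split=> [|[a b] /(_ a)//]; rewrite not_implyP => -[a /contrapT].
Qed.

Lemma class_exists (I : finType) (A : I -> set X) :
  (forall i, C (A i)) -> C [set x | exists i, A i x].
Proof.
move=> CA; suff CE (s : seq I) : C [set x | exists2 i, i \in s & A i x].
  apply: class_ext (CE (enum I)) => x /=.
  by split=> [[i _ Ai]|[i Ai]]; exists i; rewrite ?mem_enum.
elim: s => [|i s IHs]; first by apply: class_ext (class_bot hC) => x; split=> // -[].
apply: class_ext (class_or (CA i) IHs) => x /=; split=> [[Ai|[j js Aj]]|[j]].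
- by exists i; rewrite ?mem_head.
- by exists j; rewrite ?inE ?js ?orbT.
- by rewrite inE => /predU1P[->|js] Aj; [left|right; exists j].
Qed.

Lemma class_forall (I : finType) (A : I -> set X) :
  (forall i, C (A i)) -> C [set x | forall i, A i x].
Proof.
move=> CA; have CE := class_not (class_exists (fun i => class_not (CA i))).
apply: class_ext CE => x /=; split=> [nA i|Ax [i]//].
by apply: contrapT => nAi; apply: nA; exists i.
Qed.

End BooleanClassTheory.

(** * Environments and substitution *)

Definition env_nil (T : Type) (i : 'I_0) : T := False_rect T (notF (ltn_ord i)).

Section Environments.
Context {T : Type}.

Lemma env_cons0 (n : nat) (a : T) (e : 'I_n -> T) : env_cons a e ord0 = a.
Proof. by rewrite /env_cons unlift_none. Qed.

Lemma env_consS (n : nat) (a : T) (e : 'I_n -> T) (i : 'I_n) :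
  env_cons a e (lift ord0 i) = e i.
Proof. by rewrite /env_cons liftK. Qed.

Lemma env_cons_eta (n : nat) (e : 'I_n.+1 -> T) :
  env_cons (e ord0) (fun i => e (lift ord0 i)) = e.
Proof. by apply/funext=> i; rewrite /env_cons; case: unliftP => [j|] ->. Qed.

Lemma env_cat_l (n m : nat) (x : 'I_n -> T) (b : 'I_m -> T) (i : 'I_n) :
  env_cat x b (lshift m i) = x i.
Proof. by rewrite /env_cat (unsplitK (inl _ i)). Qed.

Lemma env_cat_r (n m : nat) (x : 'I_n -> T) (b : 'I_m -> T) (i : 'I_m) :
  env_cat x b (rshift n i) = b i.
Proof. by rewrite /env_cat (unsplitK (inr _ i)). Qed.

Lemma env_cat_cons (n m : nat) (a : T) (x : 'I_n -> T) (b : 'I_m -> T) :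
  @env_cat T n.+1 m (env_cons a x) b = env_cons a (env_cat x b).
Proof.
apply/funext=> i; rewrite -[i]splitK; case: (split i) => j /=.
  rewrite env_cat_l /env_cons; case: unliftP => [k|] ->.
    by rewrite [lshift m _](_ : _ = lift ord0 (lshift m k)) ?liftK ?env_cat_l //; apply/val_inj.
  by rewrite [lshift m _](_ : _ = ord0) ?unlift_none //; apply/val_inj.
rewrite env_cat_r [rshift n.+1 _](_ : _ = lift ord0 (rshift n j)) ?env_consS ?env_cat_r //.
by apply/val_inj.
Qed.

Lemma env_cat0 (n : nat) (x : 'I_0 -> T) (b : 'I_n -> T) : @env_cat T 0 n x b = b.
Proof.
by apply/funext=> i; rewrite -[in RHS](env_cat_r x b i); congr env_cat; apply/val_inj.
Qed.

End Environments.

Lemma comp_env_cons (T T' : Type) (f : T -> T') (n : nat) (a : T) (e : 'I_n -> T) :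
  (fun i => f (env_cons a e i)) = env_cons (f a) (fun i => f (e i)).
Proof. by apply/funext=> i; rewrite /env_cons; case: unlift. Qed.

Lemma comp_env_cat (T T' : Type) (f : T -> T') (n m : nat) (x : 'I_n -> T) (b : 'I_m -> T) :
  (fun i => f (env_cat x b i)) = env_cat (fun i => f (x i)) (fun i => f (b i)).
Proof. by apply/funext=> i; rewrite /env_cat; case: split. Qed.

Fixpoint tsubst (L : language) (n m : nat) (s : 'I_n -> term L m) (t : term L n) :
    term L m :=
  match t with
  | Var i => s i
  | App f ts => App (fun i => tsubst s (ts i))
  end.

Fixpoint fsubst (L : language) (n : nat) (phi : formula L n) :
    forall m, ('I_n -> term L m) -> formula L m :=
  match phi in formula _ n0 return forall m, ('I_n0 -> term L m) -> formula L m with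
  | FBot _ => fun m _ => FBot L m
  | FEq _ t u => fun m s => FEq (tsubst s t) (tsubst s u)
  | FRel _ r ts => fun m s => FRel (fun i => tsubst s (ts i))
  | FImp _ phi1 phi2 => fun m s => FImp (fsubst phi1 s) (fsubst phi2 s)
  | FAll _ phi1 => fun m s => FAll (fsubst phi1
      (env_cons (Var L ord0) (fun i => tsubst (fun j => Var L (lift ord0 j)) (s i))))
  end.

Section Substitution.
Context {L : language} {T : Type} (S : structure L T).

Lemma eval_tsubst (n m : nat) (s : 'I_n -> term L m) (t : term L n) (e : 'I_m -> T) :
  eval S e (tsubst s t) = eval S (fun i => eval S e (s i)) t.
Proof. by elim: t => //= f ts IH; congr finterp; apply/funext=> i. Qed.

Lemma sat_fsubst (n : nat) (phi : formula L n) (m : nat) (s : 'I_n -> term L m)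
    (e : 'I_m -> T) :
  sat S (fsubst phi s) e <-> sat S phi (fun i => eval S e (s i)).
Proof.
elim: phi m s e => {n} [n|n t u|n r ts|n phi1 IH1 phi2 IH2|n phi IH] m s e //=.
- by rewrite !eval_tsubst.
- by rewrite (_ : (fun i => eval S e _) = fun i => eval S (fun j => eval S e (s j)) (ts i)) //;
    apply/funext=> i; rewrite eval_tsubst.
- by split=> H /IH1 /H /IH2.
- split=> H a; move/(_ a): H; rewrite IH comp_env_cons /= env_cons0;
    by rewrite (_ : (fun i => eval S _ (tsubst _ _)) = fun i => eval S e (s i)) //;
    apply/funext=> i; rewrite eval_tsubst /=; congr eval; apply/funext=> j; rewrite env_consS.
Qed.

(** * Universal closures and transfer to all models of the theory *)

Fixpoint universal_closure (n : nat) : formula L n -> sentence L :=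
  match n with
  | 0 => id
  | n.+1 => fun phi => universal_closure (FAll phi)
  end.

Lemma sat_universal_closure (n : nat) (phi : formula L n) :
  sentence_true S (universal_closure phi) <-> forall e, sat S phi e.
Proof.
elim: n phi => [//|n IH] phi /=; rewrite IH /=; split=> H e => [|a]; last exact: H.
by rewrite -(env_cons_eta e).
Qed.

End Substitution.

(** Both implications of an equivalence valid in [S] have universal closures that belong to the
    theory of [S], so they hold in each of its models. *)
Lemma eliminates_quantifiers_theory_of (L : language) (T : Type) (S : structure L T) :
  (forall n (phi : formula L n), exists psi : formula L n,
     quantifier_free psi /\ forall e, sat S phi e <-> sat S psi e) ->
  eliminates_quantifiers (theory_of S).
Proof.
move=> QE n phi; have [psi [qf_psi E]] := QE n phi; exists psi; split=> // T' S' _ M e.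
have S'imp (chi chi' : formula L n) : (forall e, sat S chi e -> sat S chi' e) ->
    sat S' chi e -> sat S' chi' e.
  move=> H; have /M : theory_of S (universal_closure (FImp chi chi')).
    exact/sat_universal_closure.
  by move/sat_universal_closure/(_ e).
by split; apply: S'imp => e' /E.
Qed.

(** * Definable sets *)

Section Definability.
Context {L : language} {T : Type} (S : structure L T).

Lemma definableP (n m : nat) (phi : formula L (n + m)) (b : 'I_m -> T) (A : set ('I_n -> T)) :
  (forall x, A x <-> sat S phi (env_cat x b)) -> definable S A.
Proof. by move=> E; exists m, phi, b; apply/seteqP; split=> x /E. Qed.

Lemma definable_subst (n n' m : nat) (A : set ('I_n' -> T)) (s : 'I_n' -> term L (n + m))
    (c : 'I_m -> T) :
  definable S A -> definable S [set x | A (fun i => eval S (env_cat x c) (s i))].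
Proof.
move=> [m' [phi [b ->]]].
(* The parameters [c] of the terms and [b] of the definition of [A] are concatenated; [w] moves the
   terms to this larger context. *)
pose w i := tsubst (env_cat (fun j => Var L (lshift (m + m') j))
                            (fun j => Var L (rshift n (lshift m' j)))) (s i).
apply: (definableP (m := m + m') (phi := fsubst phi
  (env_cat w (fun j => Var L (rshift n (rshift m j))))) (b := env_cat c b)) => x /=.
rewrite sat_fsubst comp_env_cat.
suff -> : (fun i => eval S (env_cat x (env_cat c b)) (w i)) =
          (fun i => eval S (env_cat x c) (s i)).
  by rewrite (_ : (fun i => eval _ _ (Var _ _)) = b) //; apply/funext=> i /=; rewrite !env_cat_r.
apply/funext=> i; rewrite eval_tsubst comp_env_cat /=; congr eval; congr env_cat;
  by apply/funext=> j; rewrite ?env_cat_r env_cat_l.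
Qed.

Lemma definable_class (n : nat) : boolean_class (definable S (n := n)).
Proof.
split; first exact: (@definableP n 0 (FBot L _) (@env_nil T)).
move=> A B [m1 [phi1 [b1 ->]]] [m2 [phi2 [b2 ->]]].
apply: (definableP (m := m1 + m2) (b := env_cat b1 b2) (phi := FImp
  (fsubst phi1 (env_cat (fun i => Var L (lshift _ i)) (fun i => Var L (rshift _ (lshift _ i)))))
  (fsubst phi2 (env_cat (fun i => Var L (lshift _ i)) (fun i => Var L (rshift _ (rshift _ i)))))))
  => x /=.
rewrite !sat_fsubst !comp_env_cat /=.
have -> : (fun i => env_cat x (env_cat b1 b2) (lshift (m1 + m2) i)) = x.
  by apply/funext=> i; rewrite env_cat_l.
have -> : (fun i => env_cat x (env_cat b1 b2) (rshift n (lshift m2 i))) = b1.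
  by apply/funext=> i; rewrite env_cat_r env_cat_l.
have -> // : (fun i => env_cat x (env_cat b1 b2) (rshift n (rshift m1 i))) = b2.
by apply/funext=> i; rewrite !env_cat_r.
Qed.

Lemma definable_forall (n : nat) (A : set ('I_n.+1 -> T)) :
  definable S A -> definable S [set x | forall a, A (env_cons a x)].
Proof.
(* Parameters come last, so the bound variable stays at index 0, and [n.+1 + m] is convertible to
   [(n + m).+1]. *)
move=> [m [phi [b ->]]]; apply: (definableP (phi := FAll (phi : formula L (n + m).+1)) (b := b)) => x /=.
by split=> H a; move/(_ a): H; rewrite env_cat_cons.
Qed.

Lemma definable_exists (n : nat) (A : set ('I_n.+1 -> T)) :
  definable S A -> definable S [set x | exists a, A (env_cons a x)].
Proof.
move=> defA; have := definable_forall (class_not (definable_class _) defA).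
move/(class_not (definable_class _)); apply: class_ext => x /=.
by split=> [/existsNP[a /contrapT]|[a Aa] /(_ a)//]; exists a.
Qed.

Lemma definable_reindex (n n' : nat) (A : set ('I_n' -> T)) (s : 'I_n' -> 'I_n) :
  definable S A -> definable S [set x | A (fun i => x (s i))].
Proof.
move/(@definable_subst n n' 0 A (fun i => Var L (lshift 0 (s i)))
  (@env_nil T)).
apply: class_ext => x /=; rewrite (_ : (fun i => env_cat x _ _) = fun i => x (s i)) //.
by apply/funext=> i; rewrite env_cat_l.
Qed.

End Definability.

(** * Presburger sets *)

Definition affine (n : nat) (f : ('I_n -> int) -> int) : Prop :=
  exists (a : 'I_n -> int) (c : int), forall z, f z = \sum_i a i * z i + c.

Lemma eq_affine (n : nat) (f g : ('I_n -> int) -> int) : f =1 g -> affine f -> affine g.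
Proof. by move=> fg [a [c fE]]; exists a, c => z; rewrite -fg. Qed.

Lemma affine_const (n : nat) (c : int) : affine (fun _ : 'I_n -> int => c).
Proof. by exists (fun=> 0), c => z; rewrite big1 ?add0r // => i _; rewrite mul0r. Qed.

Lemma affine_var (n : nat) (i : 'I_n) : affine (fun z => z i).
Proof.
exists (fun j => (j == i)%:R), 0 => z; rewrite addr0 (bigD1 i) //= eqxx mul1r.
by rewrite big1 ?addr0 // => j /negbTE ->; rewrite mul0r.
Qed.

Lemma affineD (n : nat) (f g : ('I_n -> int) -> int) :
  affine f -> affine g -> affine (fun z => f z + g z).
Proof.
move=> [a [c fE]] [b [d gE]]; exists (fun i => a i + b i), (c + d) => z.
by rewrite fE gE addrACA -big_split; congr (_ + _); apply: eq_bigr => i _; rewrite mulrDl.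
Qed.

Lemma affineZ (n : nat) (k : int) (f : ('I_n -> int) -> int) :
  affine f -> affine (fun z => k * f z).
Proof.
move=> [a [c fE]]; exists (fun i => k * a i), (k * c) => z.
by rewrite fE mulrDr mulr_sumr; congr (_ + _); apply: eq_bigr => i _; rewrite mulrA.
Qed.

Lemma affineN (n : nat) (f : ('I_n -> int) -> int) : affine f -> affine (fun z => - f z).
Proof. by move/(affineZ (-1)); apply: eq_affine => z; rewrite mulN1r. Qed.

Lemma affine_sum (n : nat) (I : finType) (f : I -> ('I_n -> int) -> int) :
  (forall i, affine (f i)) -> affine (fun z => \sum_i f i z).
Proof.
move=> af; elim: (index_enum I) => [|i s IH].
  by apply: eq_affine (affine_const _ 0) => z; rewrite big_nil.
by apply: eq_affine (affineD (af i) IH) => z; rewrite big_cons.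
Qed.

(* The hypothesis [N * y i = w i z] stands for [y = w z / N]. *)
Lemma affine_subst (m n : nat) (N : int) (w : 'I_m -> ('I_n -> int) -> int)
    (f : ('I_m -> int) -> int) :
  (forall i, affine (w i)) -> affine f ->
  exists2 g, affine g & forall z y, (forall i, N * y i = w i z) -> N * f y = g z.
Proof.
move=> aw [a [c fE]]; exists (fun z => \sum_i a i * w i z + N * c).
  by apply: affineD (affine_const _ _); apply: affine_sum => i; exact: affineZ.
move=> z y yE; rewrite fE mulrDr mulr_sumr; congr (_ + _).
by apply: eq_bigr => i _; rewrite mulrCA yE.
Qed.

Lemma affine_env_cons (n : nat) (f : ('I_n.+1 -> int) -> int) : affine f ->
  exists a g, affine g /\ forall k z, f (env_cons k z) = a * k + g z.
Proof.
move=> [a [c fE]]; exists (a ord0), (fun z => \sum_i a (lift ord0 i) * z i + c); split.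
  by exists (fun i => a (lift ord0 i)), c.
move=> k z; rewrite fE big_ord_recl env_cons0 addrA; congr (_ + _ + _).
by apply: eq_bigr => i _; rewrite env_consS.
Qed.

(** Quantifier-free Presburger formulas, read as sets. The divisibility atoms are what makes the
    class closed under projection. *)
Inductive presburger (n : nat) : set ('I_n -> int) -> Prop :=
| presburger_bot : presburger [set _ | False]
| presburger_pos f : affine f -> presburger [set z | 0 < f z]
| presburger_dvd d f : 0 < d -> affine f -> presburger [set z | (d %| f z)%Z]
| presburger_imp A B : presburger A -> presburger B -> presburger [set z | A z -> B z].

Lemma presburger_class (n : nat) : boolean_class (@presburger n).
Proof. by split; [exact: presburger_bot | exact: presburger_imp]. Qed.

Lemma presburger_lt (n : nat) (f g : ('I_n -> int) -> int) :
  affine f -> affine g -> presburger [set z | f z < g z].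
Proof.
move=> af ag; apply: class_ext (presburger_pos (affineD ag (affineN af))) => z /=.
by rewrite subr_gt0.
Qed.

Lemma presburger_eq (n : nat) (f g : ('I_n -> int) -> int) :
  affine f -> affine g -> presburger [set z | f z = g z].
Proof.
move=> af ag; have pC := presburger_class n.
apply: class_ext (class_and pC (class_not pC (presburger_lt af ag))
                              (class_not pC (presburger_lt ag af))) => z /=.
by split; lia.
Qed.

(** Multiplying by [N] clears the denominator in every atom: [0 < f y] becomes [0 < N * f y], and
    divisibility of [f y] by [d] becomes divisibility of [N * f y] by [N * d]. *)
Lemma presburger_subst (m n : nat) (N : int) (w : 'I_m -> ('I_n -> int) -> int)
    (A : set ('I_m -> int)) :
  0 < N -> (forall i, affine (w i)) -> presburger A ->
  exists2 B, presburger B & forall z y, (forall i, N * y i = w i z) -> (A y <-> B z).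
Proof.
move=> N0 aw; elim=> {A} [|f af|d f d0 af|A1 A2 _ [B1 pB1 E1] _ [B2 pB2 E2]].
- by exists [set _ | False]; first exact: presburger_bot.
- have [g ag gE] := affine_subst N aw af; exists [set z | 0 < g z]; first exact: presburger_pos.
  by move=> z y /gE /= <-; rewrite pmulr_rgt0.
- have [g ag gE] := affine_subst N aw af; exists [set z | (N * d %| g z)%Z].
    by apply: presburger_dvd => //; exact: mulr_gt0.
  by move=> z y /gE /= <-; rewrite dvdz_mul2l // gt_eqF.
- exists [set z | B1 z -> B2 z]; first exact: presburger_imp.
  by move=> z y yE; rewrite /= (E1 _ _ yE) (E2 _ _ yE).
Qed.

Lemma presburger_reindex (m n : nat) (s : 'I_m -> 'I_n) (A : set ('I_m -> int)) :
  presburger A -> presburger [set z | A (fun i => z (s i))].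
Proof.
move=> /(@presburger_subst m n 1 (fun i z => z (s i)))[//|i|B pB E]; first exact: affine_var.
by apply: class_ext pB => z /=; rewrite (E z (fun i => z (s i))) // => i; rewrite mul1r.
Qed.

(** With [z] fixed, an inequality atom only sees the side of a threshold on which a multiple of [k]
    lies, and a divisibility atom only sees [k] modulo [d]. A common multiple [N] of the
    coefficients and a common modulus [D] treat all atoms at once. *)
Lemma presburger_thresholds (n : nat) (A : set ('I_n.+1 -> int)) : presburger A ->
  exists (N D : int) (T : finType) (u : T -> ('I_n -> int) -> int),
    [/\ 0 < N, 0 < D, forall t, affine (u t) &
      forall z (k k' : int), (D %| k - k')%Z -> (forall t, (u t z < N * k) = (u t z < N * k')) ->
        (A (env_cons k z) <-> A (env_cons k' z))].
Proof.
elim=> {A} [|f af|d f d0 af|A1 A2 _ [N1 [D1 [T1 [u1 [N10 D10 au1 E1]]]]]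
                                _ [N2 [D2 [T2 [u2 [N20 D20 au2 E2]]]]]].
- by exists 1, 1, void, (fun _ _ => 0).
- have [a [g [ag gE]]] := affine_env_cons af.
  have [a0|a0|a0] := ltgtP a 0.
  (* Over the integers, [0 < a * k + g z] is the negation of [g z - 1 < - a * k]. *)
  + exists (- a), 1, unit, (fun _ z => g z - 1); split=> //; first by rewrite oppr_gt0.
      by move=> _; exact: affineD (affine_const _ _).
    by move=> z k k' _ /(_ tt) /=; rewrite !gE; lia.
  + exists a, 1, unit, (fun _ z => - g z); split=> //; first by move=> _; exact: affineN.
    by move=> z k k' _ /(_ tt) /=; rewrite !gE; lia.
  + exists 1, 1, void, (fun _ _ => 0); split=> // z k k' _ _ /=.
    by rewrite !gE a0 !mul0r.
- have [a [g [_ gE]]] := affine_env_cons af.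
  exists 1, d, void, (fun _ _ => 0); split=> // z k k' dk _ /=.
  rewrite !gE (_ : a * k + g z = a * (k - k') + (a * k' + g z)); last by ring.
  by rewrite rpredDl // dvdz_mull.
(* Each threshold is scaled by the factor of the other side, to be compared with [N1 * N2 * k]. *)
exists (N1 * N2), (D1 * D2), (T1 + T2)%type,
  (fun t z => match t with inl t => N2 * u1 t z | inr t => N1 * u2 t z end).
split; [exact: mulr_gt0 | exact: mulr_gt0 | by case=> t; exact: affineZ |].
move=> z k k' dk ltE /=; rewrite (E1 z k k') ?(E2 z k k') //.
- by apply: dvdz_trans dk; rewrite dvdz_mull.
- by move=> t; have := ltE (inr t); rewrite -!mulrA !ltr_pM2l.
- by apply: dvdz_trans dk; rewrite dvdz_mulr.
- by move=> t; have := ltE (inl t); rewrite (mulrC N1) -!mulrA !ltr_pM2l.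
Qed.

(* [N * k] is moved by multiples of [N * D] towards the largest threshold below it, or else
   towards the least threshold, without crossing any threshold. *)
Lemma near_threshold (T : finType) (t0 : T) (u : T -> int) (N D k : int) :
  0 < N -> 0 < D ->
  exists (t : T) (j k' : int), [/\ `|j| <= N * D, N * k' = u t + j, (D %| k - k')%Z &
    forall t, (u t < N * k) = (u t < N * k')].
Proof.
move=> N0 D0; have ND0 : 0 < N * D by exact: mulr_gt0.
have [/existsP[t1 ut1]|/existsPn uge] := boolP [exists t, u t < N * k].
  have [t ut tmax] := Order.TotalTheory.arg_maxP (P := [pred t | u t < N * k]) u ut1.
  (* Subtracting 1 before dividing puts the final offset [r + 1] between 1 and [N * D], so [N * k']
     stays strictly above [u t]. *)
  pose q := ((N * k - u t - 1) %/ (N * D))%Z; pose r := ((N * k - u t - 1) %% (N * D))%Z.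
  have qr : N * k - u t - 1 = q * (N * D) + r by exact: divz_eq.
  have r0 : 0 <= r by rewrite modz_ge0 // gt_eqF.
  have rND : r < N * D by exact: ltz_pmod.
  have q0 : 0 <= q by rewrite divz_ge0 //; rewrite /= in ut; lia.
  have k'E : N * (k - D * q) = u t + (r + 1).
    by rewrite (_ : N * _ = N * k - q * (N * D)); [lia | ring].
  exists t, (r + 1), (k - D * q); split; [lia | by [] | |].
    by rewrite opprB addrC subrK dvdz_mulr.
  move=> s; rewrite k'E; move: ut (tmax s); rewrite inE; have : 0 <= q * (N * D) by rewrite mulr_ge0 // ltW.
  rewrite /=; lia.
have [t _ tmin] := Order.TotalTheory.arg_minP (i0 := t0) (P := predT) u isT.
have ut : N * k <= u t by have := uge t; rewrite -leNgt.
(* No shift by 1 here: thresholds are compared strictly, so [N * k' <= u t] already leaves all of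
   them on the same side. *)
pose q := ((u t - N * k) %/ (N * D))%Z; pose r := ((u t - N * k) %% (N * D))%Z.
have qr : u t - N * k = q * (N * D) + r by exact: divz_eq.
have r0 : 0 <= r by rewrite modz_ge0 // gt_eqF.
have rND : r < N * D by exact: ltz_pmod.
have k'E : N * (k + D * q) = u t - r.
  by rewrite (_ : N * _ = N * k + q * (N * D)); [lia | ring].
exists t, (- r), (k + D * q); split; [lia | by [] | |].
  by rewrite opprD addrA subrr sub0r rpredN dvdz_mulr.
by move=> s; rewrite k'E; have := tmin s isT; have := uge s; rewrite /=; lia.
Qed.

(** Cooper's argument: a solution can be moved close to a threshold, hence be sought among finitely
    many candidates [N * k = c t j z]. The quantifier becomes a finite disjunction over [t] and [j],
    whose members ask that [N] divide [c t j z] and that the formula hold after substitution. *)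
Lemma presburger_exists (n : nat) (A : set ('I_n.+1 -> int)) :
  presburger A -> presburger [set z | exists k : int, A (env_cons k z)].
Proof.
move=> pA; have [N [D [T [u [N0 D0 au uE]]]]] := presburger_thresholds pA.
(* [T] may be empty; the extra threshold 0, at [None], ensures that there is one. *)
pose v (t : option T) z := if t is Some t then u t z else 0.
have av t : affine (v t) by case: t => [t|]; [exact: au | exact: affine_const].
pose R := absz (N * D); have RE : R%:Z = N * D by rewrite /R; lia.
(* The offset [j - R] runs through all integers of absolute value at most [R = N * D]. *)
pose c t (j : 'I_(2 * R).+1) z := v t z + (j%:Z - R%:Z).
have ac t j : affine (c t j) by exact: affineD (affine_const _ _).
(* These are the coordinates of [N] times the point [env_cons k z], with the candidate in place of
   [N * k]. *)
have aw t j i : affine (fun z => env_cons (c t j z) (fun i => N * z i) i).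
  rewrite /env_cons; case: unlift => [i'|]; last exact: ac.
  by apply: affineZ; exact: affine_var.
have /choice[B BP] (tj : option T * 'I_(2 * R).+1) : exists B, presburger B /\ forall z y,
    (forall i, N * y i = env_cons (c tj.1 tj.2 z) (fun i => N * z i) i) -> (A y <-> B z).
  by have [B pB BE] := presburger_subst N0 (aw tj.1 tj.2) pA; exists B.
have pC := presburger_class n.
apply: class_ext (class_exists pC (fun tj : option T * 'I_(2 * R).+1 =>
  class_and pC (presburger_dvd N0 (ac tj.1 tj.2)) (BP tj).1)) => z /=.
have wE (k : int) t j : N * k = c t j z ->
    forall i, N * env_cons k z i = env_cons (c t j z) (fun i => N * z i) i.
  by move=> kE i; rewrite /env_cons; case: unlift.
split=> [[[t j] [/dvdzP[k kE] Bz]]|[k Ak]].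
  by exists k; apply/((BP (t, j)).2 z) => //; apply: wE; rewrite kE mulrC.
have [t [j [k' [jND k'E Dk ltE]]]] := near_threshold None (fun t => v t z) k N0 D0.
have jR : (absz (j + R%:Z)%R < (2 * R).+1)%N by lia.
have cE : N * k' = c t (Ordinal jR) z by rewrite /c k'E /=; lia.
exists (t, Ordinal jR); split; first by rewrite -cE dvdz_mulr.
apply: ((BP (t, Ordinal jR)).2 z (env_cons k' z) (wE _ _ _ cE)).1.
by apply/(uE z k k') => // s; exact: (ltE (Some s)).
Qed.

(** * Splitting into floors and fractional parts *)

Section OrderedGroup.
Context {R : realType} {L : language} (I : structure L R).
Local Notation S := (og_expansion I).

Definition og_fun (n m : nat) (c : 'I_m -> R) (f : ('I_n -> R) -> R) : Prop :=
  exists t : term (language_sum og_language L) (n + m),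
    forall x, eval S (env_cat x c) t = f x.

Section OrderedGroupFunctions.
Context (n m : nat) (c : 'I_m -> R).

Lemma og_fun_var (i : 'I_n) : og_fun c (fun x => x i).
Proof. by exists (Var _ (lshift m i)) => x /=; rewrite env_cat_l. Qed.

Lemma og_fun_param (i : 'I_m) : og_fun c (fun _ : 'I_n -> R => c i).
Proof. by exists (Var _ (rshift n i)) => x /=; rewrite env_cat_r. Qed.

Lemma og_fun_add (f g : ('I_n -> R) -> R) :
  og_fun c f -> og_fun c g -> og_fun c (fun x => f x + g x).
Proof.
move=> [t tE] [u uE].
by exists (App (f := inl og_add : Defs.fsym (language_sum og_language L))
               (fun i : 'I_2 => if i == ord0 then t else u)) => x /=; rewrite tE uE.
Qed.

(** Multiples are iterated sums. They start from zero, which no symbol of the language is known to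
    name: it has to come from a parameter. *)
Lemma og_fun_sumn (f : 'I_n -> ('I_n -> R) -> R) (k : 'I_n -> nat) :
  og_fun c (fun _ : 'I_n -> R => 0) -> (forall i, og_fun c (f i)) ->
  og_fun c (fun x => \sum_i f i x *+ k i).
Proof.
move=> f0 ff; have fk i j : og_fun c (fun x => f i x *+ j).
  elim: j => [|j [t tE]]; first exact: f0.
  have [u uE] := og_fun_add (ff i) (ex_intro _ t tE).
  by exists u => x; rewrite uE mulrS.
elim: (index_enum _) => [|i s [t tE]].
  by have [t tE] := f0; exists t => x; rewrite tE big_nil.
have [u uE] := og_fun_add (fk i (k i)) (ex_intro _ t tE).
by exists u => x; rewrite uE big_cons.
Qed.

Lemma definable_eq (f g : ('I_n -> R) -> R) :
  og_fun c f -> og_fun c g -> definable S [set x | f x = g x].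
Proof. by move=> [t tE] [u uE]; apply: (@definableP _ _ S n m (FEq t u) c) => x /=; rewrite tE uE. Qed.

Lemma definable_lt (f g : ('I_n -> R) -> R) :
  og_fun c f -> og_fun c g -> definable S [set x | f x < g x].
Proof.
move=> [t tE] [u uE].
by apply: (@definableP _ _ S n m (FRel (r := inl og_lt : rsym (language_sum og_language L))
  (fun i : 'I_2 => if i == ord0 then t else u)) c) => x /=; rewrite tE uE.
Qed.

End OrderedGroupFunctions.

Lemma definable_lt_const (n : nat) (i : 'I_n) (a : R) : definable S [set x | x i < a].
Proof. exact: (definable_lt (c := fun _ : 'I_1 => a) (og_fun_var _ i) (og_fun_param _ _ ord0)). Qed.

Lemma definable_gt_const (n : nat) (i : 'I_n) (a : R) : definable S [set x | a < x i].
Proof. exact: (definable_lt (c := fun _ : 'I_1 => a) (og_fun_param _ _ ord0) (og_fun_var _ i)). Qed.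

Lemma definable_le_const (n : nat) (i : 'I_n) (a : R) : definable S [set x | x i <= a].
Proof.
apply: class_ext (class_not (definable_class S n) (definable_gt_const i a)) => x /=.
by rewrite leNgt; split=> /negP.
Qed.

Lemma definable_ge_const (n : nat) (i : 'I_n) (a : R) : definable S [set x | a <= x i].
Proof.
apply: class_ext (class_not (definable_class S n) (definable_lt_const i a)) => x /=.
by rewrite leNgt; split=> /negP.
Qed.

Lemma definable_eq_const (n : nat) (i : 'I_n) (a : R) : definable S [set x | x i = a].
Proof. exact: (definable_eq (c := fun _ : 'I_1 => a) (og_fun_var _ i) (og_fun_param _ _ ord0)). Qed.

(** Only addition is available, so the coefficients are split into positive parts [p] and negative
    parts [q], and the equation is stated as an equality of two sums of natural multiples. The
    parameters are 0 and [a]. *)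
Lemma definable_linear (n : nat) (k : 'I_n -> int) (a : R) :
  definable S [set x | \sum_i (k i)%:~R * x i = a].
Proof.
pose c (i : 'I_2) := if i == ord0 then 0 else a.
pose p i := absz (Num.max (k i) 0); pose q i := absz (Num.max (- k i) 0).
have kE i : k i = (p i)%:Z - (q i)%:Z by rewrite /p /q; lia.
have f0 : og_fun c (fun _ : 'I_n -> R => 0) := og_fun_param n c ord0.
have fE j : og_fun c (fun x : 'I_n -> R => \sum_i x i *+ j i).
  by apply: og_fun_sumn => // i; exact: og_fun_var.
apply: class_ext (definable_eq (fE p) (og_fun_add (fE q) (og_fun_param n c ord_max))) => x /=.
have -> : \sum_i (k i)%:~R * x i = \sum_i x i *+ p i - \sum_i x i *+ q i.
  by rewrite -sumrB; apply: eq_bigr => i _; rewrite kE rmorphB /= mulrBl !mulr_natl.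
by rewrite /c /=; split=> [->|<-]; ring.
Qed.

Lemma definable_shift (n : nat) (B : set ('I_n -> R)) (c : 'I_n -> R) :
  definable S B -> definable S [set x | B (fun i => x i + c i)].
Proof.
pose t (i : 'I_n) : term (language_sum og_language L) (n + n) :=
  App (f := inl og_add : Defs.fsym (language_sum og_language L))
      (fun j : 'I_2 => if j == ord0 then Var _ (lshift n i) else Var _ (rshift n i)).
move/(definable_subst t c); apply: class_ext => x /=.
rewrite (_ : (fun i => _) = fun i => x i + c i) //.
by apply/funext=> i /=; rewrite env_cat_l env_cat_r.
Qed.

(** * Split sets and their closure properties *)

Definition floors (n : nat) (x : 'I_n -> R) (i : 'I_n) : int := Num.floor (x i).
Definition fracs (n : nat) (x : 'I_n -> R) (i : 'I_n) : R := x i - (floors x i)%:~R.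

Lemma fracs_itv (n : nat) (x : 'I_n -> R) (i : 'I_n) : 0 <= fracs x i < 1.
Proof.
have /andP[] := floor_itv (x i); rewrite intrD /fracs /floors => ge lt.
by rewrite subr_ge0 ge ltrBlDl.
Qed.

Lemma floor_frac (k : int) (s : R) : 0 <= s < 1 -> Num.floor (k%:~R + s) = k.
Proof. by move=> /andP[s0 s1]; apply: floor_def; rewrite intrD lerDl s0 ltrD2l. Qed.

(* Finite unions of products of a Presburger set by a definable set, in the identification
   of [R] with [int * [0, 1[]. *)
Inductive floor_split (n : nat) : set ('I_n -> R) -> Prop :=
| floor_split_bot : floor_split [set _ | False]
| floor_split_prod P D : presburger P -> definable S D ->
    floor_split [set x | P (floors x) /\ D (fracs x)]
| floor_split_or A B : floor_split A -> floor_split B -> floor_split [set x | A x \/ B x].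

Lemma floor_split_presburger (n : nat) (P : set ('I_n -> int)) :
  presburger P -> floor_split [set x | P (floors x)].
Proof.
move=> pP; apply: class_ext (floor_split_prod pP (class_top (definable_class S n))) => x /=.
by split=> // -[].
Qed.

Lemma floor_split_definable (n : nat) (D : set ('I_n -> R)) :
  definable S D -> floor_split [set x | D (fracs x)].
Proof.
move=> dD; apply: class_ext (floor_split_prod (class_top (presburger_class n)) dD) => x /=.
by split=> // -[].
Qed.

Lemma floor_split_and (n : nat) (A B : set ('I_n -> R)) :
  floor_split A -> floor_split B -> floor_split [set x | A x /\ B x].
Proof.
move=> sA; elim: sA B => {A} [|P D pP dD|A1 A2 _ IH1 _ IH2] B sB.
- by apply: class_ext (floor_split_bot n) => x /=; split=> // -[].
- elim: sB => {B} [|P' D' pP' dD'|B1 B2 _ IH1 _ IH2].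
  + by apply: class_ext (floor_split_bot n) => x /=; split=> // -[].
  + apply: class_ext (floor_split_prod (class_and (presburger_class n) pP pP')
                                       (class_and (definable_class S n) dD dD')) => x /=.
    by tauto.
  + by apply: class_ext (floor_split_or IH1 IH2) => x /=; tauto.
- by apply: class_ext (floor_split_or (IH1 B sB) (IH2 B sB)) => x /=; tauto.
Qed.

(** The complement of a product is the union of two products, each with one full factor; the
    complement of a union is an intersection. *)
Lemma floor_split_not (n : nat) (A : set ('I_n -> R)) :
  floor_split A -> floor_split [set x | ~ A x].
Proof.
elim=> {A} [|P D pP dD|A B _ IHA _ IHB].
- by apply: class_ext (floor_split_presburger (class_top (presburger_class n))) => x /=; split=> // _ [].
- apply: class_ext (floor_split_or
    (floor_split_presburger (class_not (presburger_class n) pP))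
    (floor_split_definable (class_not (definable_class S n) dD))) => x /=.
  by rewrite not_andE.
- by apply: class_ext (floor_split_and IHA IHB) => x /=; rewrite not_orE.
Qed.

Lemma floor_split_class (n : nat) : boolean_class (@floor_split n).
Proof.
split=> [|A B sA sB]; first exact: floor_split_bot.
apply: class_ext (floor_split_or (floor_split_not sA) sB) => x /=.
by rewrite implyE.
Qed.

Lemma floor_split_reindex (m n : nat) (s : 'I_m -> 'I_n) (A : set ('I_m -> R)) :
  floor_split A -> floor_split [set x | A (fun i => x (s i))].
Proof.
elim=> {A} [|P D pP dD|A B _ IHA _ IHB].
- exact: floor_split_bot.
- exact: (floor_split_prod (presburger_reindex s pP) (definable_reindex s dD)).
- exact: floor_split_or IHA IHB.
Qed.

(** A real number is an independent choice of an integer and of an element of [0, 1[, so the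
    projection of a product is the product of the projections, the second one restricted to [0,
    1[. *)
Lemma floor_split_exists (n : nat) (A : set ('I_n.+1 -> R)) :
  floor_split A -> floor_split [set x | exists a, A (env_cons a x)].
Proof.
elim=> {A} [|P D pP dD|A B _ IHA _ IHB].
- by apply: class_ext (floor_split_bot n) => x /=; split=> // -[].
- have dC := definable_class S n.+1.
  apply: class_ext (floor_split_prod (presburger_exists pP)
    (definable_exists (class_and dC (class_and dC (definable_ge_const ord0 0)
       (definable_lt_const ord0 1)) dD))) => x /=.
  have E a : floors (env_cons a x) = env_cons (Num.floor a) (floors x) := comp_env_cons _ _ _.
  have E' a : fracs (env_cons a x) = env_cons (a - (Num.floor a)%:~R) (fracs x).
    exact: (comp_env_cons (fun b => b - (Num.floor b)%:~R)).
  split=> [[[k Pk] [s]]|[a [Pa Da]]].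
    rewrite env_cons0 => -[[s0 s1] Ds].
    have kE : Num.floor (k%:~R + s) = k by apply: floor_frac; rewrite s0.
    by exists (k%:~R + s); rewrite E E' kE addrC addKr.
  split; first by exists (Num.floor a); rewrite -E.
  exists (a - (Num.floor a)%:~R); rewrite env_cons0 -E'; split=> //.
  by have := fracs_itv (env_cons a x) ord0; rewrite E' env_cons0 => /andP.
- apply: class_ext (floor_split_or IHA IHB) => x /=.
  by split=> [[[a ?]|[a ?]]|[a [?|?]]]; [exists a; left|exists a; right|left; exists a|right; exists a].
Qed.

Lemma floor_split_exists_env (m n : nat) (A : set ('I_(m + n) -> R)) :
  floor_split A -> floor_split [set x | exists y : 'I_m -> R, A (env_cat y x)].
Proof.
elim: m A => [|m IH] A sA.
  apply: class_ext sA => x /=.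
  split=> [Ax|[y]]; last by rewrite env_cat0.
  by exists (@env_nil R); rewrite env_cat0.
apply: class_ext (IH _ (floor_split_exists (n := m + n) sA)) => x /=.
split=> [[y [a Aay]]|[y Ay]]; first by exists (env_cons a y); rewrite env_cat_cons.
by exists (fun i => y (lift ord0 i)), (y ord0); rewrite -env_cat_cons env_cons_eta.
Qed.

(** * Functions with split graphs, and the sets defined by formulas of M *)

Definition floor_split_fun (n : nat) (f : ('I_n -> R) -> R) : Prop :=
  floor_split [set v : 'I_n.+1 -> R | v ord0 = f (fun i => v (lift ord0 i))].

(** The preimage is a projection: some [y] in [A] has [y i = f i x] for all [i]. *)
Lemma floor_split_comp (m n : nat) (A : set ('I_m -> R)) (f : 'I_m -> ('I_n -> R) -> R) :
  (forall i, floor_split_fun (f i)) -> floor_split A ->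
  floor_split [set x | A (fun i => f i x)].
Proof.
(* In the joint environment of [y] and [x], [r i] selects [y i] followed by [x], the coordinates of
   the graph of [f i]. *)
move=> sf sA; pose r i := env_cons (lshift n i) (fun j => rshift m j).
have sC := floor_split_class (m + n).
apply: class_ext (floor_split_exists_env (class_and sC
  (floor_split_reindex (fun i => lshift n i) sA)
  (class_forall sC (fun i => floor_split_reindex (r i) (sf i))))) => x /=.
have E y i : (env_cat y x (r i ord0) = f i (fun j => env_cat y x (r i (lift ord0 j)))) =
             (y i = f i x).
  rewrite /r env_cons0 env_cat_l; congr (_ = f i _); apply/funext=> j.
  by rewrite env_consS env_cat_r.
have E' y : (fun i => env_cat y x (lshift n i)) = y by apply/funext=> i; rewrite env_cat_l.
split=> [[y [Ay yE]]|Af].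
  by move: Ay; rewrite E' (_ : y = fun i => f i x) //; apply/funext=> i; rewrite -E.
by exists (fun i => f i x); rewrite E'; split=> // i; rewrite E.
Qed.

(** The sum is an integer part, coming from the floors, plus a contribution of the fractional parts.
    If it vanishes, that contribution is an integer, a carry, of absolute value at most the sum [K]
    of the [|k i|]. Each of the finitely many carries gives one product. *)
Lemma floor_split_linear (n : nat) (k : 'I_n -> int) :
  floor_split [set x | \sum_i (k i)%:~R * x i = 0].
Proof.
pose K := absz (\sum_i `|k i|); have KE : K%:Z = \sum_i `|k i|.
  by rewrite gez0_abs // sumr_ge0.
have aS : affine (fun z : 'I_n -> int => \sum_i k i * z i).
  by apply: affine_sum => i; exact/affineZ/affine_var.
apply: class_ext (class_exists (floor_split_class n) (fun j : 'I_(2 * K).+1 =>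
  floor_split_prod (presburger_eq aS (affine_const n (K%:Z - j%:Z)))
                   (definable_linear k (j%:Z - K%:Z)%:~R))) => x /=.
have E : \sum_i (k i)%:~R * x i =
    (\sum_i k i * floors x i)%:~R + \sum_i (k i)%:~R * fracs x i.
  rewrite rmorph_sum -big_split /=; apply: eq_bigr => i _.
  by rewrite rmorphM -mulrDr /fracs addrC subrK.
rewrite E; split=> [[j [-> ->]]|/eqP]; first by rewrite -rmorphD /= addrC subrKA subrr.
rewrite addrC addr_eq0 -rmorphN /= => /eqP F.
have bd : `|- (\sum_i k i * floors x i)| <= K%:Z.
  rewrite -(ler_int R) intr_norm -F KE rmorph_sum /=.
  apply: le_trans (ler_norm_sum _ _ _) _; apply: ler_sum => i _.
  rewrite normrM -intr_norm ler_piMr //; have /andP[f0 f1] := fracs_itv x i.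
  by rewrite ger0_norm // ltW.
move: F bd; move: (\sum_i k i * floors x i) => m F bd; rewrite F.
have jK : (absz (K%:Z - m)%R < (2 * K).+1)%N by clear -bd; lia.
exists (Ordinal jK); rewrite /=; split; first by clear -bd; lia.
by congr (_%:~R); lia.
Qed.

Lemma floor_split_eq (n : nat) (i j : 'I_n) : floor_split [set x | x i = x j].
Proof.
pose s (l : 'I_2) := if l == ord0 then i else j.
pose k (l : 'I_2) : int := if l == ord0 then 1 else -1.
apply: class_ext (floor_split_reindex s (floor_split_linear k)) => x /=.
rewrite !big_ord_recl big_ord0 /= mul1r rmorphN mulN1r addr0.
by split=> [/eqP|->]; rewrite ?subrr // subr_eq0 => /eqP.
Qed.

(** The order of the reals is lexicographic in the floor and the fractional part. *)
Lemma floor_split_lt (n : nat) (i j : 'I_n) : floor_split [set x | x i < x j].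
Proof.
have sC := floor_split_class n.
apply: class_ext (class_or sC
  (floor_split_presburger (presburger_lt (affine_var i) (affine_var j)))
  (floor_split_prod (presburger_eq (affine_var i) (affine_var j))
     (definable_lt (og_fun_var (@env_nil R) i) (og_fun_var _ j)))) => x /=.
have xE l : x l = (floors x l)%:~R + fracs x l by rewrite /fracs addrC subrK.
rewrite (xE i) (xE j); have := fracs_itv x i; have := fracs_itv x j.
move: (floors x i) (floors x j) (fracs x i) (fracs x j) => a b s t /andP[t0 t1] /andP[s0 s1].
have [ab|ba|->] := ltgtP a b.
- split=> [_|_]; last by left.
  by move: ab; rewrite -lezD1 -(ler_int R) intrD; lra.
- split=> [[//|[/eqP]]|]; first by rewrite gt_eqF.
  by move: ba; rewrite -lezD1 -(ler_int R) intrD; lra.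
- by rewrite ltrD2l; split=> [[//|[]//]|?]; right.
Qed.

(** A bounded set meets only finitely many integer translates of the unit cube; in each of them the
    floors are constant and the fractional parts range over a translate of [B]. *)
Lemma floor_split_bounded (n : nat) (B : set ('I_n -> R)) :
  bounded_subset B -> definable S B -> floor_split B.
Proof.
move=> [M BM] dB; pose K := (absz (Num.ceil M)).+1.
(* The margin of 1 gives [M < K], so the floors of points of [B] lie in [-K, K[. *)
have MK : M <= K%:~R - 1.
  by rewrite -(intrB _ K 1) -ceil_le_int /K; move: (Num.ceil M) => k; lia.
pose c (l : {ffun 'I_n -> 'I_(2 * K).+1}) i : int := (l i)%:Z - K%:Z.
have pC := presburger_class n.
apply: class_ext (class_exists (floor_split_class n) (fun l =>
  floor_split_prod (class_forall pC (fun i => presburger_eq (affine_var i) (affine_const n (c l i))))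
    (definable_shift (fun i => (c l i)%:~R) dB))) => x /=.
have E l : (forall i, floors x i = c l i) -> (fun i => fracs x i + (c l i)%:~R) = x.
  by move=> xl; apply/funext=> i; rewrite -xl subrK.
split=> [[l [xl]]|Bx]; first by rewrite E.
have xK i : - K%:Z <= floors x i < K%:Z.
  have := BM x Bx i; rewrite ler_norml => /andP[Mx xM].
  by rewrite floor_ge_int floor_lt_int rmorphN /=; apply/andP; split; lra.
have lK i : (absz (floors x i + K%:Z)%R < (2 * K).+1)%N by have := xK i; lia.
have xl i : floors x i = c [ffun i => Ordinal (lK i)] i.
  by rewrite /c ffunE /=; have := xK i; lia.
by exists [ffun i => Ordinal (lK i)]; rewrite E.
Qed.

(** Addition, and scaling once the denominator is cleared, are linear equations with integer
    coefficients. The value of the floor function has the same floor as its argument and fractional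
    part 0. *)
Lemma floor_split_finterp (f : M_fsym) :
  floor_split_fun (finterp (M_structure S) (f := f : Defs.fsym (M_language S))).
Proof.
case: f => [|a|] /=.
- pose k (l : 'I_3) : int := if l == ord0 then 1 else -1.
  apply: class_ext (floor_split_linear k) => x /=.
  rewrite !big_ord_recl big_ord0 /= mul1r rmorphN !mulN1r addr0.
  rewrite (_ : lift ord0 (lift ord0 ord0) = lift ord0 ord_max); last exact/val_inj.
  by rewrite -opprD; split=> [/eqP|->]; rewrite ?subrr // subr_eq0 => /eqP.
- pose k (l : 'I_2) : int := if l == ord0 then denq a else - numq a.
  apply: class_ext (floor_split_linear k) => x /=.
  rewrite !big_ord_recl big_ord0 /= rmorphN addr0 mulNr.
  have d0 : (denq a)%:~R != 0 :> R by rewrite intr_eq0 denq_neq0.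
  rewrite /ratr; split=> [/eqP|->]; last by field.
  by rewrite subr_eq0 => /eqP E; apply: (mulfI d0); rewrite E; field.
- apply: class_ext (floor_split_prod
    (presburger_eq (affine_var ord0) (affine_var (lift ord0 ord0)))
    (definable_eq_const ord0 0)) => x /=.
  rewrite /fracs /floors; split=> [[<- /eqP]|->]; first by rewrite subr_eq0 => /eqP.
  by rewrite intrKfloor subrr.
Qed.

Lemma floor_split_rinterp (r : M_rsym S) :
  floor_split (fun x => rinterp (M_structure S) (r := r : rsym (M_language S)) x).
Proof.
case: r => [|B|] /=.
- exact: floor_split_lt.
- exact: floor_split_bounded (@bd_bounded _ _ _ B) (@bd_definable _ _ _ B).
- apply: class_ext (floor_split_definable (definable_eq_const ord0 0)) => x /=.
  rewrite intrEfloor /fracs /floors; split=> [/eqP|/eqP ->]; last by rewrite subrr.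
  by rewrite subr_eq0 eq_sym.
Qed.

Lemma floor_split_eval (n : nat) (t : term (M_language S) n) :
  floor_split_fun (fun x => eval (M_structure S) x t).
Proof.
elim: t => [i|f ts IH]; first exact: floor_split_eq.
(* The candidate value followed by the evaluated arguments: the graph of the compound term is the
   preimage under [g] of the graph of [f]. *)
pose g i (v : 'I_n.+1 -> R) := env_cons (v ord0)
  (fun j => eval (M_structure S) (fun i => v (lift ord0 i)) (ts j)) i.
have sg i : floor_split_fun (g i).
  rewrite /g /env_cons; case: unlift => [j|]; last exact: floor_split_eq.
  apply: class_ext (floor_split_reindex (env_cons ord0 (fun i => lift ord0 (lift ord0 i))) (IH j)).
  move=> v /=; rewrite env_cons0.
  by rewrite (_ : (fun i => v (env_cons _ _ _)) = fun i => v (lift ord0 (lift ord0 i))) //;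
    apply/funext=> l; rewrite env_consS.
apply: class_ext (floor_split_comp sg (floor_split_finterp f)) => v /=.
rewrite /g env_cons0.
by rewrite (_ : (fun i => env_cons _ _ _) =
  fun j => eval (M_structure S) (fun i => v (lift ord0 i)) (ts j)) //;
  apply/funext=> l; rewrite env_consS.
Qed.

Lemma floor_split_sat (n : nat) (phi : formula (M_language S) n) :
  floor_split [set x | sat (M_structure S) phi x].
Proof.
elim: phi => {n} [n|n t u|n r ts|n phi1 IH1 phi2 IH2|n phi IH] /=.
- exact: floor_split_bot.
- apply: (floor_split_comp (f := fun i : 'I_2 => if i == ord0 then fun x => eval _ x t
    else fun x => eval _ x u) _ (floor_split_eq ord0 ord_max)) => i.
  by case: ifP => _; exact: floor_split_eval.
- exact: floor_split_comp (fun i => floor_split_eval (ts i)) (floor_split_rinterp r).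
- exact: class_imp (floor_split_class n) _ _ IH1 IH2.
- apply: class_ext (floor_split_not (floor_split_exists (floor_split_not IH))) => x /=.
  split=> [nE a|Ax [a]//]; apply: contrapT => nphi; apply: nE; by exists a.
Qed.

End OrderedGroup.

(** * Quantifier-free definitions of split sets *)

(** Divisibility means that [m / d] and [- c / d] differ by an integer, that is, have equal
    fractional parts. This form is expressible by a rational scaling and the floor function. *)
Lemma dvdz_frac (R : realType) (d m c : int) : 0 < d ->
  (d %| m + c)%Z <->
  m%:~R / d%:~R - (Num.floor (m%:~R / d%:~R : R))%:~R =
  - c%:~R / d%:~R - (Num.floor (- c%:~R / d%:~R : R))%:~R :> R.
Proof.
move=> d0; have dR : d%:~R != 0 :> R by rewrite intr_eq0 gt_eqF.
split=> [/dvdzP[q E]|E].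
  have -> : m%:~R / d%:~R = q%:~R + - c%:~R / d%:~R :> R.
    by rewrite (_ : m = q * d - c) ?rmorphB ?rmorphM /=; [field | lia].
  by rewrite floorDzr // intrKfloor rmorphD /=; ring.
move: E; set a := Num.floor _; set b := Num.floor _ => E.
apply/dvdzP; exists (a - b); apply: (@intr_inj R); rewrite rmorphM rmorphB rmorphD /=.
by rewrite (_ : a%:~R - b%:~R = m%:~R / d%:~R + c%:~R / d%:~R); [field | lra].
Qed.

Section QuantifierFree.
Context {R : realType} {L : language} (I : structure L R).
Local Notation S := (og_expansion I).
Local Notation M := (M_structure S).

(** Unlike in [definable], no parameters are allowed: real constants can only enter through the
    symbols for bounded definable sets. *)
Definition qf_definable (n : nat) (A : set ('I_n -> R)) : Prop :=
  exists psi : formula (M_language S) n,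
    quantifier_free psi /\ forall x, sat M psi x <-> A x.

Definition M_fun (n : nat) (f : ('I_n -> R) -> R) : Prop :=
  exists t : term (M_language S) n, forall x, eval M x t = f x.

Lemma qf_definable_class (n : nat) : boolean_class (@qf_definable n).
Proof.
split=> [|A B [phi [qphi E]] [psi [qpsi F]]]; first by exists (FBot _ n).
by exists (FImp phi psi); split=> [|x] /=; rewrite ?qphi // E F.
Qed.

Lemma qf_definable_bounded (m n : nat) (B : set ('I_m -> R)) (f : 'I_m -> ('I_n -> R) -> R) :
  (0 < m)%N -> bounded_subset B -> definable S B -> (forall i, M_fun (f i)) ->
  qf_definable [set x | B (fun i => f i x)].
Proof.
move=> m0 bB dB /choice[t tE]; pose r := BoundedDefinable m0 bB dB.
exists (FRel (r := M_bounded r : rsym (M_language S)) t); split=> // x /=.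
by rewrite (_ : (fun i => eval M x (t i)) = fun i => f i x) //; apply/funext=> i.
Qed.

Lemma qf_definable_lt (n : nat) (f g : ('I_n -> R) -> R) :
  M_fun f -> M_fun g -> qf_definable [set x | f x < g x].
Proof.
move=> [t tE] [u uE].
exists (FRel (r := M_lt S : rsym (M_language S)) (fun i : 'I_2 => if i == ord0 then t else u)).
by split=> // x /=; rewrite tE uE.
Qed.

Section Terms.
Context {n : nat}.
Implicit Types f g : ('I_n.+1 -> R) -> R.

Lemma M_fun_var (i : 'I_n.+1) : M_fun (fun x => x i).
Proof. by exists (Var _ i). Qed.

Lemma M_fun_floor f : M_fun f -> M_fun (fun x => (Num.floor (f x))%:~R).
Proof.
move=> [t tE].
by exists (App (f := M_floor : Defs.fsym (M_language S)) (fun=> t)) => x /=; rewrite tE.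
Qed.

Lemma M_fun_scale (a : rat) f : M_fun f -> M_fun (fun x => ratr a * f x).
Proof.
move=> [t tE].
by exists (App (f := M_scale a : Defs.fsym (M_language S)) (fun=> t)) => x /=; rewrite tE.
Qed.

Lemma M_fun_add f g : M_fun f -> M_fun g -> M_fun (fun x => f x + g x).
Proof.
move=> [t tE] [u uE].
by exists (App (f := M_add : Defs.fsym (M_language S))
               (fun i : 'I_2 => if i == ord0 then t else u)) => x /=; rewrite tE uE.
Qed.

Lemma M_fun_sub f g : M_fun f -> M_fun g -> M_fun (fun x => f x - g x).
Proof.
move=> sf sg; have [t tE] := M_fun_add sf (M_fun_scale (-1) sg).
by exists t => x; rewrite tE rmorphN rmorph1 mulN1r.
Qed.

(** Every function symbol has positive arity, so there are no closed terms: zero is 0 times a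
    variable, whence the dimension [n.+1]. *)
Lemma M_fun0 : M_fun (fun _ : 'I_n.+1 -> R => 0).
Proof.
by have [t tE] := M_fun_scale 0 (M_fun_var ord0); exists t => x; rewrite tE rmorph0 mul0r.
Qed.

(** The constant [c] is kept apart because no term is available for it; only the linear part [l]
    becomes a term. *)
Lemma M_fun_affine (h : ('I_n.+1 -> int) -> int) : affine h ->
  exists (c : int) (l : ('I_n.+1 -> int) -> int),
    M_fun (fun x => (l (floors x))%:~R) /\ forall z, h z = l z + c.
Proof.
move=> [a [c hE]]; exists c, (fun z => \sum_i a i * z i); split=> //.
elim: (index_enum _) => [|i s [t tE]].
  by have [t tE] := M_fun0; exists t => x; rewrite tE big_nil.
have [u uE] := M_fun_add (M_fun_scale (a i)%:~R (M_fun_floor (M_fun_var i))) (ex_intro _ t tE).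
by exists u => x; rewrite uE big_cons rmorphD rmorphM /= ratr_int.
Qed.

Lemma qf_definable_bounded1 (B : set R) (b : R) f :
  (forall y, B y -> `|y| <= b) -> definable S [set v : 'I_1 -> R | B (v ord0)] -> M_fun f ->
  qf_definable [set x | B (f x)].
Proof.
move=> Bb dB sf; apply: (qf_definable_bounded (f := fun _ : 'I_1 => f) (ltn0Sn 0) _ dB) => //.
by exists b => v /Bb ? i; rewrite ord1.
Qed.

(* There are no constant symbols: the comparison with [a] is a comparison with [0], corrected by
   bounded intervals. *)
Lemma qf_definable_gt_const (a : R) f : M_fun f -> qf_definable [set x | a < f x].
Proof.
move=> sf; have qC := qf_definable_class n.+1; have dC := definable_class S 1.
have q1 : qf_definable [set x | 0 <= f x /\ f x <= `|a|].
  apply: (@qf_definable_bounded1 [set y | 0 <= y /\ y <= `|a|] `|a|) => //.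
    by move=> y [y0 ya]; rewrite ger0_norm.
  exact: class_and dC _ _ (definable_ge_const I ord0 0) (definable_le_const I ord0 `|a|).
have q2 : qf_definable [set x | a < f x /\ f x <= `|a|].
  apply: (@qf_definable_bounded1 [set y | a < y /\ y <= `|a|] `|a|) => //.
    move=> y [ay ya]; rewrite ler_norml ya andbT (le_trans _ (ltW ay)) //.
    by rewrite lerNl -normrN ler_norm.
  exact: class_and dC _ _ (definable_gt_const I ord0 a) (definable_le_const I ord0 `|a|).
apply: class_ext (class_or qC q2 (class_and qC (qf_definable_lt M_fun0 sf) (class_not qC q1))) => x /=.
have := ler_norm a; have := normr_ge0 a; move: (f x) `|a| => y b b0 ab.
split=> [[[]//|[y0 ny]]|ay].
  by rewrite (le_lt_trans ab) // ltNge; apply/negP => yb; apply: ny; rewrite ltW.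
have [yb|yb] := leP y b; [by left | right; split; first exact: le_lt_trans yb].
by case.
Qed.

Lemma qf_definable_presburger (P : set ('I_n.+1 -> int)) :
  presburger P -> qf_definable [set x | P (floors x)].
Proof.
elim=> {P} [|h ah|d h d0 ah|P Q _ IHP _ IHQ].
- exact: class_bot (qf_definable_class _).
- have [c [g [sg hE]]] := M_fun_affine ah.
  apply: class_ext (qf_definable_gt_const (- c%:~R) sg) => x /=.
  by rewrite hE -subr_gt0 opprK -rmorphD ltr0z.
- have [c [g [sg hE]]] := M_fun_affine ah.
  have sg' := M_fun_scale d%:~R^-1 sg.
  (* Divisibility now says that a term takes the value [v], and the singleton of [v] is a bounded
     definable set. *)
  pose v : R := - c%:~R / d%:~R - (Num.floor (- c%:~R / d%:~R : R))%:~R.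
  have sE : qf_definable [set x | ratr d%:~R^-1 * (g (floors x))%:~R -
      (Num.floor (ratr d%:~R^-1 * (g (floors x))%:~R : R))%:~R = v].
    apply: (@qf_definable_bounded1 [set y | y = v] `|v|); first by move=> y /= ->.
      exact: definable_eq_const.
    exact: M_fun_sub sg' (M_fun_floor sg').
  have dE : ratr d%:~R^-1 = d%:~R^-1 :> R by rewrite fmorphV /= ratr_int.
  apply: class_ext sE => x /=; rewrite hE (dvdz_frac R) // dE.
  by rewrite (mulrC _ (g (floors x))%:~R).
- exact: class_imp (qf_definable_class _) _ _ IHP IHQ.
Qed.

(** [D] may be unbounded, but fractional parts lie in the unit cube, and the intersection of [D]
    with the cube has a symbol in the language. *)
Lemma qf_definable_fracs (D : set ('I_n.+1 -> R)) :
  definable S D -> qf_definable [set x | D (fracs x)].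
Proof.
move=> dD; have dC := definable_class S n.+1.
have dU : definable S [set x : 'I_n.+1 -> R | forall i, 0 <= x i /\ x i <= 1].
  apply: class_forall => // i.
  exact: class_and dC _ _ (definable_ge_const I i 0) (definable_le_const I i 1).
have sF i : M_fun (fun x : 'I_n.+1 -> R => fracs x i).
  exact: M_fun_sub (M_fun_var i) (M_fun_floor (M_fun_var i)).
apply: class_ext (qf_definable_bounded (ltn0Sn n) _ (class_and dC dU dD) sF) => [x /=|].
  split=> [[]//|Dx]; split=> // i.
  by have /andP[-> /ltW] := fracs_itv x i.
by exists 1 => x [x01 _] i; have [x0 x1] := x01 i; rewrite ger0_norm.
Qed.

End Terms.

Lemma qf_definable_floor_split (n : nat) (A : set ('I_n -> R)) :
  floor_split I A -> qf_definable A.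
Proof.
case: n A => [|n] A sA.
  (* Without variables there are no terms, but the environment is unique, so [A] is empty or
     full. *)
  have [A0|nA0] := pselect (A (@env_nil R)).
    apply: class_ext (class_top (qf_definable_class 0)) => x; split=> // _.
    by rewrite (_ : x = @env_nil R) //; apply/funext=> -[].
  apply: class_ext (class_bot (qf_definable_class 0)) => x; split=> //.
  by rewrite (_ : x = @env_nil R) //; apply/funext=> -[].
have qC := qf_definable_class n.+1.
elim: sA => {A} [|P D pP dD|A B _ IHA _ IHB]; first exact: class_bot qC.
  exact: class_and qC _ _ (qf_definable_presburger pP) (qf_definable_fracs dD).
exact: class_or qC _ _ IHA IHB.
Qed.

End QuantifierFree.

Theorem theorem5p3 (R : realType) (L : language) (I : structure L R)
  (omin : o_minimal (og_expansion I)) :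
  eliminates_quantifiers (theory_of (M_structure (og_expansion I))).
Proof.
apply: eliminates_quantifiers_theory_of => n phi.
have [psi [qf_psi E]] := qf_definable_floor_split (floor_split_sat phi).
by exists psi; split=> // e; rewrite E.
Qed.
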